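(* Let $k$ be a field and $G$ a (totally) ordered abelian group. Let $R\subseteq\mathrm{LRS}(k,G)$ be such that $K=\langle R\rangle$ is a Hahn field. Suppose that for any $x\in\mathrm{Hom}(G,k^\times)$ we have $\rho_x^*(R)\subseteq R$. Then $K$ has the canonical second lifting property.
   Context: $k((G))$ denotes the field of generalised power series: all functions $s\colon G\to k$, written $s=\sum_{g\in G}s_gt^g$, whose support $\mathrm{supp}(s)=\{g\mid s_g\neq 0\}$ is a well-ordered subset of $G$, with pointwise addition and convolution product. $k[G]$ is the subring of all $s$ with finite support and $k(G)$ its fraction field inside $k((G))$. A Hahn field is a field $K$ with $k(G)\subseteq K\subseteq k((G))$; it carries the canonical valuation $v(s)=\min\mathrm{supp}(s)$ for $s\neq 0$. Linear recurrence sequences: $\mathrm{LRS}(k,G)$ is the set of partial functions $r\colon G\rightharpoonup k$ with well-ordered domain $\mathrm{dom}(r)$. $\mathrm{supp}(r)=\{g\in\mathrm{dom}(r)\mid r(g)\neq 0\}$ and $r^*=\sum_{g\in\mathrm{dom}(r)}r(g)t^g\in k((G))$. $\langle r\rangle$ is the set of all $s\in k((G))$ with $\sum_{g\in\mathrm{dom}(r)}r(g)s_{h-g}=0$ for every $h\in G\setminus\mathrm{dom}(r)$ (a sum with finitely many non-zero terms), and $\langle R\rangle=\bigcup_{r\in R}\langle r\rangle$. Associated maps: for $r\in\mathrm{LRS}(k,G)$, let $\widetilde{r}$ be the linear recurrence sequence with domain $\mathrm{dom}(r)$, $\widetilde{r}(g)=r(g)$ for $g\in\mathrm{supp}(r)$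 and $\widetilde{r}(g)=1$ for $g\in\mathrm{dom}(r)\setminus\mathrm{supp}(r)$. For a map $\varphi\colon k((G))\to k((G))$, the map $\varphi^*\colon\mathrm{LRS}(k,G)\to\mathrm{LRS}(k,G)$ is defined by $\mathrm{dom}(\varphi^*(r))=\mathrm{supp}(\varphi(\widetilde{r}^{\,*}))$ and $\varphi^*(r)(g)=\varphi(r^* )(g)$ for $g\in\mathrm{dom}(\varphi^*(r))$. Lifting: $\mathrm{Hom}(G,k^\times)$ is the group of group homomorphisms $x\colon G\to k^\times$, $g\mapsto x^g$. For such $x$, $\rho_x\colon k((G))\to k((G))$, $\sum_gs_gt^g\mapsto\sum_gs_gx^gt^g$. $\mathrm{Int\,Aut}(K)$ is the group of field automorphisms $\sigma$ of $K$ that are valuation preserving ($v(a)=v(b)$ implies $v(\sigma(a))=v(\sigma(b))$) and induce the identity on $k$ and $G$, i.e. the coefficient of $t^0$ in $\sigma(c)$ equals $c$ for all $c\in k$, and $v(\sigma(a))=v(a)$ for all $a\in K^\times$. $K$ has the canonical second lifting property if $\rho_x|_K\in\mathrm{Int\,Aut}(K)$ for all $x\in\mathrm{Hom}(G,k^\times)$; equivalently, $\rho_x(s)\in K$ for all $s\in K$ and all such $x$. *)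

(* Defs.v *)
From HB Require Import structures.
From mathcomp Require Import all_boot all_order all_algebra.
From mathcomp Require Import wochoice all_classical.

Set Implicit Arguments.
Unset Strict Implicit.
Unset Printing Implicit Defensive.
Import Order.TTheory GRing.Theory.
Local Open Scope classical_set_scope.
Local Open Scope ring_scope.

(* Totality is part of the mixin because a join of GRing.Zmodule with         *)
(* Order.Total cannot be declared downstream of the numeric hierarchy.        *)
HB.mixin Record isOrderedZmodule G of Num.POrderedZmodule G := {
  oz_le_total : forall x y : G, (x <= y) || (y <= x);
  le_add2l : forall z x y : G, x <= y -> z + x <= z + y
}.

#[short(type="orderedZmodType")]
HB.structure Definition OrderedZmodule :=
  { G of Num.POrderedZmodule G & isOrderedZmodule G }.

Section OrderedZmodule.
Variable G : orderedZmodType.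
Implicit Types (x y z : G) (A B C : set G).

Lemma oz_leNgt x y : (x <= y) = ~~ (y < x).
Proof. by rewrite comparable_leNgt //; exact: oz_le_total. Qed.

Lemma oz_ltNge x y : (x < y) = ~~ (y <= x).
Proof. by rewrite oz_leNgt negbK. Qed.

Lemma oz_le_add2l z x y : (z + x <= z + y) = (x <= y).
Proof.
apply/idP/idP => [/(le_add2l (- z))|]; last exact: le_add2l.
by rewrite !addKr.
Qed.

Lemma oz_lt_add2l z x y : (z + x < z + y) = (x < y).
Proof. by rewrite !lt_neqAle oz_le_add2l (inj_eq (addrI z)). Qed.

Lemma oz_le_add2r z x y : (x + z <= y + z) = (x <= y).
Proof. by rewrite ![_ + z]addrC oz_le_add2l. Qed.

Lemma oz_le_sub2l z x y : (z - x <= z - y) = (y <= x).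
Proof.
by rewrite oz_le_add2l -(oz_le_add2l (x + y)) addrK addrAC subrr add0r.
Qed.

Definition well_ordered A : bool := `[< wo_chain <=%R [in A] >].

Lemma well_orderedP A : reflect
  (forall B, B `<=` A -> B !=set0 -> exists2 m, B m & forall b, B b -> m <= b)
  (well_ordered A).
Proof.
apply: (iffP (asboolP _)) => [woA B BA [b Bb]|woA].
  have [||m [[mB mmin] _]] := woA [in B].
  - by move=> x; rewrite !inE; exact: BA.
  - by exists b; rewrite inE.
  exists m => [|c Bc]; first by move: mB; rewrite inE.
  by apply: mmin; rewrite inE.
apply: antisymmetric_wo_chain => [x y _ _|B BA [b Bb]]; first exact: le_anti.
have [x Bx||m Bm mmin] := woA [set` B].
- by have := BA _ Bx; rewrite inE.
- by exists b.
by exists m.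
Qed.

Lemma sub_well_ordered A B : A `<=` B -> well_ordered B -> well_ordered A.
Proof.
move=> AB /well_orderedP woB; apply/well_orderedP => C CA.
by apply: woB; exact: subset_trans AB.
Qed.

Lemma well_ordered0 : well_ordered set0.
Proof. by apply/well_orderedP => B B0 [b /B0]. Qed.

Lemma well_ordered1 x : well_ordered [set x].
Proof.
apply/well_orderedP => B Bx [b Bb]; exists b => // c Bc.
by rewrite (Bx _ Bb) (Bx _ Bc).
Qed.

Lemma well_orderedU A B :
  well_ordered A -> well_ordered B -> well_ordered (A `|` B).
Proof.
move=> /well_orderedP woA /well_orderedP woB; apply/well_orderedP => C CAB C0.
have [CA0|CA0] := pselect (C `&` A !=set0); last first.
  by apply: woB C0 => c Cc; case: (CAB _ Cc) => // Ac; case: CA0; exists c.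
have [CB0|CB0] := pselect (C `&` B !=set0); last first.
  by apply: woA C0 => c Cc; case: (CAB _ Cc) => // Bc; case: CB0; exists c.
have [a [Ca _] amin] := woA _ (@subIsetr _ C A) CA0.
have [b [Cb _] bmin] := woB _ (@subIsetr _ C B) CB0.
have [ab|ba] := orP (oz_le_total a b).
  exists a => // c Cc; case: (CAB _ Cc) => ?; first exact: amin.
  by apply: le_trans ab _; exact: bmin.
exists b => // c Cc; case: (CAB _ Cc) => ?; last exact: bmin.
by apply: le_trans ba _; exact: amin.
Qed.

Lemma well_orderedD A B : well_ordered A -> well_ordered B ->
  well_ordered [set h | exists2 g, A g & B (h - g)].
Proof.
move=> /well_orderedP woA /well_orderedP woB; apply/well_orderedP => C CAB C0.
have amin D : D `<=` C -> D !=set0 -> exists a b, [/\ A a, B b, D (a + b) &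
    forall a' b', A a' -> B b' -> D (a' + b') -> a <= a'].
  move=> DC [d Dd]; have [a Aa Bda] := CAB _ (DC _ Dd).
  have [||a0 [Aa0 [b0 [Bb0 Dab0]]] a0min] :=
    woA [set a | A a /\ exists b, B b /\ D (a + b)].
  - by move=> ? [].
  - by exists a; split=> //; exists (d - a); split=> //; rewrite subrKC.
  exists a0, b0; split=> // a' b' Aa' Bb' Dab'.
  by apply: a0min; split=> //; exists b'.
pose Q b := B b /\ exists a, [/\ A a, C (a + b) & forall a' b', A a' -> B b' ->
  C (a' + b') -> a' + b' <= a + b -> a <= a'].
have [||b [Bb [a [Aa Cab abmin]]] bmin] := woB Q.
- by move=> ? [].
- have [a [b [Aa Bb Cab abmin]]] := amin C (@subset_refl _ C) C0.
  exists b; split=> //; exists a; split=> // a' b' Aa' Bb' Cab' _.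
  exact: abmin Cab'.
exists (a + b) => // c Cc; rewrite oz_leNgt; apply/negP => cab.
have [||a' [b' [Aa' Bb' [Cab' ltab'] min']]] := amin [set d | C d /\ d < a + b].
- by move=> ? [].
- by exists c.
have leaa' : a <= a' by apply: abmin Cab' (ltW ltab').
have : b <= b'.
  apply: bmin; split=> //; exists a'; split=> // a2 b2 Aa2 Bb2 Cab2 le2.
  by apply: (min' _ b2) => //; split=> //; exact: le_lt_trans ltab'.
rewrite oz_leNgt => /negP; apply.
rewrite -(oz_lt_add2l a); apply: le_lt_trans ltab'.
by rewrite oz_le_add2r.
Qed.

Lemma well_ordered_finite A B h : well_ordered A -> well_ordered B ->
  finite_set [set g | A g /\ B (h - g)].
Proof.
move=> /well_orderedP woA /well_orderedP woB.
set S := [set g | _]; apply: contrapT => Sinf.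
have smax D : D `<=` S -> D !=set0 -> exists2 m, D m & forall d, D d -> d <= m.
  move=> DS [d Dd]; have [||m [Bm Dm] mmin] := woB [set b | B b /\ D (h - b)].
  - by move=> ? [].
  - by exists (h - d); split; [case: (DS _ Dd)|rewrite subKr].
  exists (h - m) => // e De; rewrite -[e](subKr h) oz_le_sub2l.
  by apply: mmin; split; [case: (DS _ De)|rewrite subKr].
pose below g := S `&` [set s | s <= g].
have [||g [Sg ginf] gmin] := woA [set g | S g /\ ~ finite_set (below g)].
- by move=> ? [[]].
- have [|m Sm mmax] := smax S (@subset_refl _ S); first exact: infinite_setN0.
  exists m; split=> //; rewrite /below (_ : _ `&` _ = S)//.
  by apply/seteqP; split=> [? []//|s Ss]; split=> //; exact: mmax.
have [[d [Sd dg]]|none] := pselect (S `&` [set s | s < g] !=set0); last first.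
  apply: ginf; apply: (@sub_finite_set _ _ [set g]); last exact: finite_set1.
  move=> s [Ss]; rewrite /= le_eqVlt => /orP[/eqP//|sg].
  by case: none; exists s.
have [|| g' [Sg' g'g] g'max] := smax (S `&` [set s | s < g]).
- by move=> ? [].
- by exists d.
suff : g <= g' by rewrite oz_leNgt g'g.
apply: gmin; split=> // g'fin; apply: ginf.
apply: (@sub_finite_set _ _ ([set g] `|` below g')).
  move=> s [Ss]; rewrite /= le_eqVlt => /orP[/eqP->|sg]; first by left.
  by right; split=> //; exact: g'max.
by rewrite finite_setU; split=> //; exact: finite_set1.
Qed.

End OrderedZmodule.


Section FiniteSums.
Variable V : nmodType.

Lemma fsum_split (I : choiceType) (D : set I) (f g : I -> V) :
  finite_set (D `&` f @^-1` [set~ 0]) -> finite_set (D `&` g @^-1` [set~ 0]) ->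
  \sum_(i \in D) (f i + g i) = \sum_(i \in D) f i + \sum_(i \in D) g i.
Proof.
move=> ffin gfin; set F := D `&` f @^-1` _ in ffin.
set E := D `&` g @^-1` _ in gfin.
have w (u : I -> V) : (forall i, D i -> ~ (F `|` E) i -> u i = 0) ->
    \sum_(i \in F `|` E) u i = \sum_(i \in D) u i.
  move=> u0; apply: fsbig_widen; first by move=> i [[]|[]].
  by move=> i [Di /(u0 _ Di)].
rewrite -!w ?fsbig_split ?finite_setU//.
- by move=> i Di /not_orP[_ nE]; apply: contrapT => gi; apply: nE.
- by move=> i Di /not_orP[nF _]; apply: contrapT => fi; apply: nF.
- move=> i Di /not_orP[nF nE].
  suff [-> ->] : f i = 0 /\ g i = 0 by rewrite addr0.
  split; apply: contrapT => ui; [exact: nF|exact: nE].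
Qed.

Lemma fsum_exchange (I J : choiceType) (P : set I) (Q : set J)
    (F : I -> J -> V) : finite_set P -> finite_set Q ->
    (forall i j, F i j <> 0 -> P i /\ Q j) ->
  \sum_(i \in [set: I]) \sum_(j \in [set: J]) F i j =
  \sum_(j \in [set: J]) \sum_(i \in [set: I]) F i j.
Proof.
move=> Pfin Qfin FPQ.
have Fj i : \sum_(j \in Q) F i j = \sum_(j \in [set: J]) F i j.
  by apply: fsbig_widen => // j [_ Qj]; apply: contrapT => /FPQ[].
have Fi j : \sum_(i \in P) F i j = \sum_(i \in [set: I]) F i j.
  by apply: fsbig_widen => // i [_ Pi]; apply: contrapT => /FPQ[].
under eq_fsbigr do rewrite -Fj; under [RHS]eq_fsbigr do rewrite -Fi.
rewrite -(fsbig_widen P)//; last first.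
  by move=> i [_ Pi]; apply: fsbig1 => j _; apply: contrapT => /FPQ[].
rewrite -[RHS](fsbig_widen Q)//; last first.
  by move=> j [_ Qj]; apply: fsbig1 => i _; apply: contrapT => /FPQ[].
exact: exchange_fsbig.
Qed.

End FiniteSums.

Definition supp (G : Type) (k : nmodType) (s : G -> k) : set G :=
  [set g | s g != 0].

(* k((G)) *)
Record hahn (k : fieldType) (G : orderedZmodType) := Hahn {
  coef :> G -> k;
  hahn_wo : well_ordered (supp coef)
}.

Section HahnRing.
Variables (k : fieldType) (G : orderedZmodType).
Local Notation hahn := (hahn k G).
Implicit Types s t u : hahn.

Lemma hahnP s t : s =1 t -> s = t.
Proof.
case: s t => s ws [t wt] /= /funext st; move: ws wt; rewrite st => ws wt.
by congr Hahn.
Qed.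

HB.instance Definition _ := gen_eqMixin hahn.
HB.instance Definition _ := gen_choiceMixin hahn.

Definition monom_fun (c : k) (g : G) : G -> k :=
  fun h => if h == g then c else 0.

Lemma monom_wo c g : well_ordered (supp (monom_fun c g)).
Proof.
apply: sub_well_ordered (well_ordered1 g) => h /=.
by rewrite /supp /monom_fun/=; case: (h =P g) => // _; rewrite eqxx.
Qed.

Definition monom c g : hahn := Hahn (monom_wo c g).

Lemma hadd_wo s t : well_ordered (supp (fun g => s g + t g)).
Proof.
apply: sub_well_ordered (well_orderedU (hahn_wo s) (hahn_wo t)) => g /=.
rewrite /supp/=; have [->|s0] := eqVneq (s g) 0; last by left.
by rewrite add0r; right.
Qed.

Lemma hopp_wo s : well_ordered (supp (fun g => - s g)).
Proof.
by apply: sub_well_ordered (hahn_wo s) => g; rewrite /supp/= oppr_eq0.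
Qed.

Definition hzero := monom 0 0.
Definition hadd s t : hahn := Hahn (hadd_wo s t).
Definition hopp s : hahn := Hahn (hopp_wo s).

Lemma monom0E g h : monom 0 g h = 0.
Proof. by rewrite /monom/= /monom_fun if_same. Qed.

Lemma haddA : associative hadd.
Proof. by move=> s t u; apply/hahnP => g /=; rewrite addrA. Qed.
Lemma haddC : commutative hadd.
Proof. by move=> s t; apply/hahnP => g /=; rewrite addrC. Qed.
Lemma hadd0 : left_id hzero hadd.
Proof. by move=> s; apply/hahnP => g; rewrite /= /monom_fun if_same add0r. Qed.
Lemma haddN : left_inverse hzero hopp hadd.
Proof. by move=> s; apply/hahnP => g; rewrite [RHS]monom0E /= addNr. Qed.

HB.instance Definition _ := GRing.isZmodule.Build hahn haddA haddC hadd0 haddN.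

(* The sum has finitely many nonzero terms, by hmul_finite.                   *)
Definition hmul_fun s t : G -> k :=
  fun h => \sum_(g \in [set: G]) s g * t (h - g).

Lemma hmul_finite s t h : finite_set [set g | s g * t (h - g) <> 0].
Proof.
apply: sub_finite_set (well_ordered_finite h (hahn_wo s) (hahn_wo t)).
move=> g /= st; rewrite /supp/=.
by split; apply/eqP => st0; apply: st; rewrite st0 ?mul0r ?mulr0.
Qed.

Lemma hmul_wo s t : well_ordered (supp (hmul_fun s t)).
Proof.
apply: sub_well_ordered (well_orderedD (hahn_wo s) (hahn_wo t)) => h.
rewrite /supp /hmul_fun /= => st; apply: contrapT => nst.
move/eqP: st; apply; apply: fsbig1 => g _; apply: contrapT => st0.
by apply: nst; exists g => /=; apply/eqP => st1; apply: st0;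
  rewrite st1 ?mul0r ?mulr0.
Qed.

Definition hmul s t : hahn := Hahn (hmul_wo s t).

Lemma hmulC : commutative hmul.
Proof.
move=> s t; apply/hahnP => h; rewrite /= /hmul_fun.
have hK : involutive (fun g => h - g) by move=> g; rewrite subKr.
rewrite (reindex_fsbigT (fun g => h - g)) ; last exact: inv_bij.
by apply: eq_fsbigr => g _ /=; rewrite subKr mulrC.
Qed.

Lemma hmul1 : left_id (monom 1 0) hmul.
Proof.
move=> s; apply/hahnP => h; rewrite /= /hmul_fun.
rewrite -(fsbig_widen [set 0])//; last first.
  by move=> g [_ /= /eqP/negPf g0]; rewrite /monom_fun g0 mul0r.
by rewrite fsbig_set1 /= /monom_fun eqxx mul1r subr0.
Qed.

Lemma hmulDl : left_distributive hmul hadd.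
Proof.
move=> s t u; apply/hahnP => h; rewrite /= /hmul_fun.
under eq_fsbigr do rewrite /= mulrDl.
by apply: fsum_split; rewrite setTI; exact: hmul_finite.
Qed.

Lemma hmulA : associative hmul.
Proof.
move=> s t u; apply/hahnP => h; rewrite /= /hmul_fun /=.
pose F g w := s g * t (w - g) * u (h - w).
pose D (a b : hahn) := [set h | exists2 g, supp a g & supp b (h - g)].
transitivity (\sum_(g \in [set: G]) \sum_(w \in [set: G]) F g w).
  apply: eq_fsbigr => g _; rewrite mulr_fsumr.
  rewrite (reindex_fsbigT (fun w => w - g)); last first.
    by exists (fun v => v + g) => v; rewrite ?subrK ?addrK.
  apply: eq_fsbigr => w _; rewrite /F mulrA; congr (_ * u _).
  by rewrite opprB addrA subrK.
rewrite (@fsum_exchange _ _ _ [set g | supp s g /\ D t u (h - g)]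
  [set w | D s t w /\ supp u (h - w)]).
- by apply: eq_fsbigr => w _; rewrite mulr_fsuml.
- by apply: well_ordered_finite (hahn_wo s) _; apply: well_orderedD;
    exact: hahn_wo.
- by apply: well_ordered_finite _ (hahn_wo u); apply: well_orderedD;
    exact: hahn_wo.
- move=> g w /eqP; rewrite /F !mulf_eq0 !negb_or => /andP[/andP[sg tw] uw].
  split; split=> //; last by exists g.
  by exists (w - g) => //; rewrite /supp/= opprB addrA subrK.
Qed.

Fact hone_neq0 : monom 1 0 != 0.
Proof.
apply/eqP => /(congr1 (fun s : hahn => s 0)) /=.
by rewrite /monom_fun if_same eqxx => /eqP; rewrite oner_eq0.
Qed.

HB.instance Definition _ := GRing.Zmodule_isComNzRing.Build hahn
  hmulA hmulC hmul1 hmulDl hone_neq0.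

Lemma hahn0E g : (0 : hahn) g = 0. Proof. exact: monom0E. Qed.
Lemma hahn1E g : (1 : hahn) g = (g == 0)%:R.
Proof. by rewrite /= /monom_fun; case: eqP. Qed.
Lemma hahnDE s t g : (s + t) g = s g + t g. Proof. by []. Qed.
Lemma hahnNE s g : (- s) g = - s g. Proof. by []. Qed.
Lemma hahnME s t h : (s * t) h = \sum_(g \in [set: G]) s g * t (h - g).
Proof. by []. Qed.

End HahnRing.

Arguments monom {k G} c g.

Section HahnFields.
Variables (k : fieldType) (G : orderedZmodType).
Local Notation hahn := (hahn k G).
Implicit Types (s a b : hahn) (K : set hahn) (sigma : hahn -> hahn).

(* v(s), with None standing for v(0) = oo.                                    *)
Definition hval s : option G :=
  if s == 0 then None
  else Some (xget 0 [set g | minimum_of <=%R [in supp s] g]).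

Lemma hval0 : hval 0 = None.
Proof. by rewrite /hval eqxx. Qed.

Lemma hvalP s : s != 0 -> exists g,
  [/\ hval s = Some g, s g != 0 & forall h, s h != 0 -> g <= h].
Proof.
move=> s0; rewrite /hval (negPf s0); eexists; split; first by [].
  case: xgetP => [g _ [+ _]|nomin]; first by rewrite inE.
all: have [||m [mmin _]] := asboolW (hahn_wo s) [in supp s]; first by [].
1,3: have [[g sg]|s00] := pselect (supp s !=set0); first by exists g; rewrite inE.
1,2: case/eqP: s0; apply/hahnP => g; rewrite hahn0E; apply/eqP/negPn/negP => sg.
1,2: by apply: s00; exists g.
- by case: (nomin m).
- case: xgetP => [g _ [_ gmin] h sh|/(_ m)//]; by apply: gmin; rewrite inE.
Qed.

(* k[G] and k(G): the latter consists of those s which are quotients a / b    *)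
(* of elements of k[G].                                                       *)
Definition group_ring : set hahn := [set s | finite_set (supp s)].
Definition group_field : set hahn :=
  [set s | exists a b, [/\ group_ring a, group_ring b, b != 0 & b * s = a]].

Definition subfield K :=
  subring_closed [in K] /\
  forall a, K a -> a != 0 -> exists2 b, K b & a * b = 1.

Definition hahn_field K := subfield K /\ group_field `<=` K.

(* Maps of K into itself are given by maps of k((G)), of which only the       *)
(* restriction to K matters.                                                  *)
Definition field_automorphism K sigma :=
  [/\ set_bij K K sigma,
      {in K &, {morph sigma : a b / a + b}},
      {in K &, {morph sigma : a b / a * b}} & sigma 1 = 1].

Definition valuation_preserving K sigma :=
  {in K &, forall a b, hval a = hval b -> hval (sigma a) = hval (sigma b)}.

Definition int_aut K : set (hahn -> hahn) := [set sigma |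
  [/\ field_automorphism K sigma, valuation_preserving K sigma,
      forall c : k, sigma (monom c 0) 0 = c &
      {in K, forall a, a != 0 -> hval (sigma a) = hval a}]].

(* Hom(G, k^x)                                                                *)
Record unit_hom := UnitHom {
  unit_hom_fun :> G -> k;
  unit_hom_neq0 : forall g, unit_hom_fun g != 0;
  unit_homD : {morph unit_hom_fun : g h / g + h >-> g * h}
}.

Lemma rho_wo (x : unit_hom) s : well_ordered (supp (fun g => s g * x g)).
Proof.
apply: sub_well_ordered (hahn_wo s) => g; rewrite /supp /=.
by rewrite mulf_eq0 negb_or => /andP[].
Qed.

Definition rho (x : unit_hom) s : hahn := Hahn (rho_wo x s).

Definition canonical_second_lifting K := forall x : unit_hom, int_aut K (rho x).

End HahnFields.

(* Partial functions from G to k, with None outside the domain.               *)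
Definition dom (G k : Type) (r : G -> option k) : set G :=
  [set g | r g <> None].

Record LRS (k : fieldType) (G : orderedZmodType) := Lrs {
  lrs_fun :> G -> option k;
  lrs_wo : well_ordered (dom lrs_fun)
}.

Section LinearRecurrenceSequences.
Variables (k : fieldType) (G : orderedZmodType).
Local Notation hahn := (hahn k G).
Local Notation LRS := (LRS k G).
Implicit Types (r : LRS) (R : set LRS) (phi : hahn -> hahn).

(* The value of r, extended by 0 outside its domain.                          *)
Definition lrs_val r (g : G) : k := odflt 0 (r g).

Lemma lrs_hahn_wo r : well_ordered (supp (lrs_val r)).
Proof.
apply: sub_well_ordered (lrs_wo r) => g; rewrite /supp /lrs_val /dom /=.
by case: (r g) => //=; rewrite eqxx.
Qed.

(* r^*                                                                        *)
Definition lrs_hahn r : hahn := Hahn (lrs_hahn_wo r).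

(* The sum has finitely many nonzero terms, by lrs_sum_finite.                *)
Definition lrs_space r : set hahn := [set s |
  forall h, ~ dom r h -> \sum_(g \in dom r) lrs_val r g * s (h - g) = 0].

Lemma lrs_sum_finite r (s : hahn) h :
  finite_set [set g | dom r g /\ lrs_val r g * s (h - g) <> 0].
Proof. by apply: sub_finite_set (hmul_finite (lrs_hahn r) s h) => g []. Qed.

Definition lrs_spaces R : set hahn := \bigcup_(r in R) lrs_space r.

Definition lrs_tilde_fun r (g : G) : option k :=
  omap (fun c => if c == 0 then 1 else c) (r g).

Lemma lrs_tilde_wo r : well_ordered (dom (lrs_tilde_fun r)).
Proof.
apply: sub_well_ordered (lrs_wo r) => g; rewrite /dom /lrs_tilde_fun /=.
by case: (r g).
Qed.

Definition lrs_tilde r : LRS := Lrs (lrs_tilde_wo r).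

Definition lrs_map_fun phi r (g : G) : option k :=
  if g \in supp (phi (lrs_hahn (lrs_tilde r)))
  then Some (phi (lrs_hahn r) g) else None.

Lemma lrs_map_wo phi r : well_ordered (dom (lrs_map_fun phi r)).
Proof.
apply: sub_well_ordered (hahn_wo (phi (lrs_hahn (lrs_tilde r)))) => g.
by rewrite /dom /lrs_map_fun /=; case: ifPn => // /set_mem.
Qed.

(* phi^*                                                                      *)
Definition lrs_map phi r : LRS := Lrs (lrs_map_wo phi r).

End LinearRecurrenceSequences.

(* Main.v *)
Require Import Defs.
From mathcomp Require Import all_boot all_order all_algebra.
From mathcomp Require Import wochoice all_classical.

Import GRing.Theory.
Local Open Scope classical_set_scope.
Local Open Scope ring_scope.

(** The map [r |-> rho_x^*(r)] keeps the domain of [r] and multiplies [r(g)] by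
    [x^g]. Since [x^g x^(h-g) = x^h], the recurrence of [rho_x^*(r)] for
    [rho_x(s)] at [h] is [x^h] times that of [r] for [s], so [rho_x] maps [<r>]
    into [<rho_x^*(r)>]. Hence [rho_x] and its inverse, which is given by the
    character [x^-1], map [K] into itself. Finally [rho_x] is a ring morphism of
    [k((G))] that does not change supports. *)

Section UnitHom.
Variables (k : fieldType) (G : orderedZmodType).
Implicit Types (x : unit_hom k G) (s t : hahn k G) (r : LRS k G).

Lemma unit_hom0 x : x 0 = 1.
Proof.
by apply: (mulfI (unit_hom_neq0 x 0)); rewrite -unit_homD addr0 mulr1.
Qed.

Lemma unit_hom_subrK x g h : x g * x (h - g) = x h.
Proof. by rewrite -unit_homD addrC subrK. Qed.

Lemma unit_homV_neq0 x g : (x g)^-1 != 0.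
Proof. by rewrite invr_eq0 unit_hom_neq0. Qed.

Lemma unit_homVD x : {morph (fun g => (x g)^-1) : g h / g + h >-> g * h}.
Proof. by move=> g h; rewrite unit_homD invfM. Qed.

Definition unit_homV x : unit_hom k G :=
  UnitHom (unit_homV_neq0 x) (unit_homVD x).

Lemma rhoE x s g : rho x s g = s g * x g.
Proof. by []. Qed.

Lemma rhoK x : cancel (rho x) (rho (unit_homV x)).
Proof. by move=> s; apply/hahnP => g; rewrite !rhoE mulfK ?unit_hom_neq0. Qed.

Lemma rhoVK x : cancel (rho (unit_homV x)) (rho x).
Proof. by move=> s; apply/hahnP => g; rewrite !rhoE mulfVK ?unit_hom_neq0. Qed.

Lemma rhoD x : {morph rho x : s t / s + t}.
Proof. by move=> s t; apply/hahnP => g; rewrite !(hahnDE, rhoE) mulrDl. Qed.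

Lemma rho_monom0 x (c : k) : rho x (monom c 0) = monom c 0.
Proof.
apply/hahnP => g; rewrite rhoE /= /monom_fun.
by case: eqP => [->|_]; rewrite ?unit_hom0 ?mulr1 ?mul0r.
Qed.

(** In the convolution at [h], the factor [x h] splits as [x g * x (h - g)] within each term. *)
Lemma rhoM x : {morph rho x : s t / s * t}.
Proof.
move=> s t; apply/hahnP => h; rewrite rhoE !hahnME mulr_fsuml.
by apply: eq_fsbigr => g _; rewrite !rhoE mulrACA unit_hom_subrK.
Qed.

Lemma supp_rho x s : supp (rho x s) = supp s.
Proof.
by apply/seteqP; split=> g; rewrite /supp /= mulf_eq0 (negPf (unit_hom_neq0 x g))
  orbF.
Qed.

Lemma rho_eq0 x s : (rho x s == 0) = (s == 0).
Proof.
(* The zero of k((G)) is by definition [monom 0 0]. *)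
have rho0 : rho x 0 = 0 := rho_monom0 x 0.
by rewrite -{1}rho0 (inj_eq (can_inj (rhoK x))).
Qed.

(** [hval] sees a series only through its vanishing and its support. *)
Lemma hval_rho x s : hval (rho x s) = hval s.
Proof. by rewrite /hval rho_eq0 supp_rho. Qed.

(** Since [lrs_tilde] turns the zero values of [r] into 1, the support of its series is all of
    [dom r], and [rho x] keeps it. Thus points of [dom r] where [r] vanishes stay in the domain,
    with value 0. *)
Lemma lrs_map_rhoE x r g : lrs_map (rho x) r g = omap (fun c => c * x g) (r g).
Proof.
have supp_mem s : (g \in supp s) = (s g != 0).
  by apply/idP/idP => [/set_mem|sg]; last exact: mem_set.
rewrite /= /lrs_map_fun supp_rho supp_mem /= /lrs_val /= /lrs_tilde_fun.
case: (r g) => [c|] /=; last by rewrite eqxx.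
by have [_|->] := eqVneq c 0; rewrite ?oner_eq0.
Qed.

Lemma dom_lrs_map_rho x r : dom (lrs_map (rho x) r) = dom r.
Proof.
by apply/seteqP; split=> g; rewrite /dom /mkset lrs_map_rhoE; case: (r g).
Qed.

Lemma lrs_val_map_rho x r g : lrs_val (lrs_map (rho x) r) g = lrs_val r g * x g.
Proof. by rewrite /lrs_val lrs_map_rhoE; case: (r g) => //=; rewrite mul0r. Qed.

Lemma lrs_space_rho x r s :
  lrs_space r s -> lrs_space (lrs_map (rho x) r) (rho x s).
Proof.
move=> rs h; rewrite dom_lrs_map_rho => /rs rsh.
(* Writing the right-hand 0 as the recurrence of [r] for [s] at [h], times [x h], makes both sides
   agree term by term. *)
rewrite -[RHS](mul0r (x h)) -[in RHS]rsh mulr_fsuml; apply: eq_fsbigr => g _.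
by rewrite lrs_val_map_rho rhoE mulrACA unit_hom_subrK.
Qed.

Lemma lrs_spaces_rho x (R : set (LRS k G)) s :
  lrs_map (rho x) @` R `<=` R -> lrs_spaces R s -> lrs_spaces R (rho x s).
Proof.
move=> Rx [r Rr rs]; exists (lrs_map (rho x) r); last exact: lrs_space_rho.
by apply: Rx; exists r.
Qed.

(** Stability is assumed for all characters [y], not just [x]: preimages under [rho x] are found in
    [K] by applying [rho (unit_homV x)]. *)
Lemma rho_int_aut x (K : set (hahn k G)) :
  (forall y s, K s -> K (rho y s)) -> int_aut K (rho x).
Proof.
move=> Krho; split.
- split; [split| | |].
  + by move=> s; exact: Krho.
  + by move=> s t _ _; exact: (can_inj (rhoK x)).
  + move=> s Ks; exists (rho (unit_homV x) s); first exact: Krho.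
    exact: rhoVK.
  + by move=> s t _ _; exact: rhoD.
  + by move=> s t _ _; exact: rhoM.
  + exact: rho_monom0.
- by move=> s t _ _; rewrite !hval_rho.
- by move=> c; rewrite rho_monom0 /= /monom_fun eqxx.
- by move=> s _ _; exact: hval_rho.
Qed.

End UnitHom.

Theorem theorem8p18 (k : fieldType) (G : orderedZmodType)
    (R : set (LRS k G)) (K : set (hahn k G))
    (K_def : K = lrs_spaces R) (K_hahn : hahn_field K)
    (R_stable : forall x : unit_hom k G, lrs_map (rho x) @` R `<=` R) :
  canonical_second_lifting K.
Proof.
by move=> x; apply: rho_int_aut => y s; rewrite K_def; exact: lrs_spaces_rho.
Qed.
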